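(* (Influence of the cut in four-player straight poker.) Let $D'_{\mathrm{poker}}=(1234)^5 5^{32}$, a deck of $n=52$ cards with values $1,2,3,4,5$ (exponents denote repetition of a word), and let $\sigma\in S_{52}$ be the cycle $(1,2,\ldots,52)$. Then $$\overline{\kappa}_1(D'_{\mathrm{poker}})=\frac{1041539930128654272599}{123600572196960202344},\qquad \overline{\kappa}_1(\sigma^{16}D'_{\mathrm{poker}})=\frac{523485619699747366033}{126685078454994859800},$$ and cutting after the 16th card is the best cut: $\overline{\kappa}_1(\sigma^{16}D'_{\mathrm{poker}})\le\overline{\kappa}_1(\sigma^{m}D'_{\mathrm{poker}})$ for all $0\le m\le 51$.
   Context: A deck of $n$ cards is a function $D$ from $\{1,\dots,n\}$ to a set of values, written as the word $D(1)D(2)\cdots D(n)$. A permutation $\pi\in S_n$ acts on decks by moving the card in position $i$ to position $\pi(i)$: $(\pi D)(\pi(i))=D(i)$. Thus $\sigma^m D'_{\mathrm{poker}}$ is the cyclic shift of $D'_{\mathrm{poker}}$ by $m$ positions; it is the effective deal sequence when $m$ cards are moved from the top to the bottom of the shuffled deck before dealing according to $D'_{\mathrm{poker}}$. $\mathcal O(D')$ is the set of all reorderings of $D'$, $N=\#\mathcal O(D')$, and $n_v$ is the number of cards of value $v$ in $D'$. A $u$-$v$ digraph in $D$ is an index $i$ with $D(i)=u$, $D(i+1)=v$. A $u$-$v$ pair in $D$ is a pair $(i,j)$ with $i<j$, $D(i)=u$, $D(j)=v$. Define $W(D,u,v)=\#\{u\text{-}v\text{ digraphs in }D\}-\#\{v\text{-}u\text{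 digraphs in }D\}$ and $Z(D,u,v)=\#\{u\text{-}v\text{ pairs in }D\}-\#\{v\text{-}u\text{ pairs in }D\}$. For $D\in\mathcal O(D')$, $$c_1(D,D')=\frac{n}{2N}\sum_{u<v}\frac{W(D,u,v)Z(D',u,v)}{n_un_v},\qquad \overline{\kappa}_1(D')=\frac12\sum_{D\in\mathcal O(D')}|c_1(D,D')|.$$ *)

(* Defs.v *)
From mathcomp Require Import all_boot all_order all_fingroup all_algebra.

Set Implicit Arguments.
Unset Strict Implicit.
Unset Printing Implicit Defensive.

Import Order.TTheory GRing.Theory Num.Theory.

(* Positions are numbered from 0: 'I_n stands for {1, ..., n}. *)
Definition deck (n : nat) (V : Type) := {ffun 'I_n -> V}.

Section Decks.
Context {disp : Order.disp_t} {n : nat} {V : finOrderType disp}.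
Implicit Types (D : deck n V) (u v : V).

(* The card in position i moves to position p i, i.e. (p D)(p i) = D i. *)
Definition permute_deck (p : 'S_n) D : deck n V := [ffun j => D (p^-1%g j)].

Definition reorderings D : {set deck n V} :=
  [set permute_deck p D | p : 'S_n].

Definition num_value D v : nat := #|[set i : 'I_n | D i == v]|.

(* An index i is represented by the pair (i, i + 1), so that the last position,
   which has no successor, never contributes. *)
Definition digraphs D u v : {set 'I_n * 'I_n} :=
  [set ij : 'I_n * 'I_n |
    [&& (ij.2 == ij.1.+1 :> nat), D ij.1 == u & D ij.2 == v]].

Definition pairs D u v : {set 'I_n * 'I_n} :=
  [set ij : 'I_n * 'I_n | [&& (ij.1 < ij.2)%N, D ij.1 == u & D ij.2 == v]].

Local Open Scope ring_scope.

Definition deckW D u v : rat := #|digraphs D u v|%:R - #|digraphs D v u|%:R.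

Definition deckZ D u v : rat := #|pairs D u v|%:R - #|pairs D v u|%:R.

(* A value v : V absent from D' contributes 0: for D in reorderings D', both
   deckW D and deckZ D' then vanish, and 0 / 0 = 0. *)
Definition c1 (D D' : deck n V) : rat :=
  n%:R / (2 * #|reorderings D'|%:R) *
  \sum_(u : V) \sum_(v : V | (u < v)%O)
    deckW D u v * deckZ D' u v / ((num_value D' u)%:R * (num_value D' v)%:R).

Definition kappa1_bar (D' : deck n V) : rat :=
  2^-1 * \sum_(D in reorderings D') `|c1 D D'|.

End Decks.

(* The card value k, for 1 <= k <= 5, is the k-th element of 'I_5. *)
Definition card_value (k : nat) : 'I_5 := inord k.-1.

Definition poker_word : seq 'I_5 :=
  flatten (nseq 5 [seq card_value k | k <- [:: 1; 2; 3; 4]]) ++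
  nseq 32 (card_value 5).

Definition poker_deck : deck 52 'I_5 :=
  [ffun i : 'I_52 => nth (card_value 5) poker_word i].

(* The cycle (1, 2, ..., 52): ordS i is i + 1 mod 52. *)
Definition sigma : 'S_52 := perm (@ordS_inj 52).

(* Main.v *)
(** Write D' for the deck after the cut. Since W counts consecutive cards, the sum
    of W(D,u,v) Z(D',u,v) / (n_u n_v) over u < v is the sum of the antisymmetric
    function f(u,v) = Z(D',u,v) / (n_u n_v) along the consecutive cards of D. For a
    cut of the poker deck, 5 f(u,v) is +1 or -1 on distinct values below 5 (according
    to their order) and 0 against the value 5, up to a coboundary z(u) - z(v). Hence
    the sum is determined by the number of rises and falls of D among the values
    below 5 and by the first and the last card of D, where only z depends on the cut.

    The joint distribution of these four statistics over all reorderings is obtained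
    by inserting the values one after the other. The m cards of a new value go to r of
    the gaps of the current word in binomial(m - 1, r - 1) ways, and every gap that
    receives cards changes the statistics in a way that depends only on whether it
    was a rise, a fall, a level or an end of the word. This makes the distribution
    small enough to be computed exactly and evaluated for each of the 52 cuts. *)
Require Import Defs.
From Stdlib Require Import BinNat BinInt.
From mathcomp Require Import all_boot all_order all_fingroup all_algebra.
From mathcomp Require Import ring lra zify ssrZ.

Set Implicit Arguments.
Unset Strict Implicit.
Unset Printing Implicit Defensive.

Import Order.TTheory GRing.Theory Num.Theory.

(** * Insertion of equal cards into a word *)

(* Values are numbered from 0, and 4 (the card value 5) is neutral: it takes part in
   no rise and no fall. *)
Definition asc_pair (a b : nat) : nat := (a < b) && (b < 4).
Definition des_pair (a b : nat) : nat := asc_pair b a.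

Fixpoint asc (a : nat) (s : seq nat) : nat :=
  if s is b :: s' then asc_pair a b + asc b s' else 0.

Fixpoint des (a : nat) (s : seq nat) : nat :=
  if s is b :: s' then des_pair a b + des b s' else 0.

Fixpoint lev (a : nat) (s : seq nat) : nat :=
  if s is b :: s' then (asc_pair a b + des_pair a b == 0) + lev b s' else 0.

Lemma asc_des_lev a s : asc a s + des a s + lev a s = size s.
Proof.
elim: s a => // b s IH a /=; move: (IH b); rewrite /des_pair /asc_pair.
by case: (ltngtP a b) => ?; case: (b < 4); case: (a < 4) => /=; lia.
Qed.

(** The number of ways to write m as an ordered sum of r positive parts: m cards are shared among r
    gaps, each of which receives some. *)
Definition compositions (m r : nat) : nat :=
  match m, r with
  | 0, 0 => 1
  | m'.+1, r'.+1 => 'C(m', r')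
  | _, _ => 0
  end.

(** The first part is either 1, and is then removed, or larger, and is then lowered by 1. *)
Lemma compositionsS m r :
  compositions m.+1 r.+1 = compositions m r + compositions m r.+1.
Proof. by case: m r => [|m] [|r] //=; rewrite ?bin0 ?bin1 // binS addnC. Qed.

Lemma compositions_small m r : m < r -> compositions m r = 0.
Proof. by case: m r => [|m] [|r] //= mr; rewrite bin_small. Qed.

(** All shuffles of w with m copies of v. A branch shortens either w or the supply of copies, whence
    the nested recursion. *)
Fixpoint insertions (v : nat) (w : seq nat) : nat -> seq (seq nat) :=
  match w with
  | [::] => fun m => [:: nseq m v]
  | a :: w' => fix insert_in m :=
      [seq a :: s | s <- insertions v w' m] ++
      (if m is m'.+1 then [seq v :: s | s <- insert_in m'] else [::])
  end.

Lemma insertions_cons v a w m :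
  insertions v (a :: w) m =
    [seq a :: s | s <- insertions v w m] ++
    (if m is m'.+1 then [seq v :: s | s <- insertions v (a :: w) m'] else [::]).
Proof. by case: m. Qed.

Lemma insertions_notin v w m s : v \notin w ->
  (s \in insertions v w m) = ([seq x <- s | x != v] == w) && (count_mem v s == m).
Proof.
elim: w m s => [|a w IHw] m s.
  move=> _; rewrite inE; apply/eqP/andP => [->|[]].
    by rewrite filter_nseq count_nseq /= eqxx /= mul1n.
  rewrite -size_eq0 size_filter -leqn0 leqNgt -has_count => /hasPn vs /eqP <-.
  have sv : all (pred1 v) s by apply/allP => x /vs; rewrite negbK.
  by move: (sv); rewrite all_count => /eqP ->; apply/all_pred1P.
rewrite inE negb_or => /andP[va vw].
elim: m s => [|m IHm] [|x s]; rewrite insertions_cons mem_cat.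
- by apply/negbTE; rewrite orbF; apply/negP => /mapP[].
- rewrite orbF /=; have [->|xv] := eqVneq x v.
    by rewrite add1n andbF; apply/negP => /mapP[y _ [/eqP]]; rewrite (negPf va).
  rewrite add0n eqseq_cons; apply/mapP/andP => [[y + [-> ->]]|[/andP[/eqP-> ys] cs]].
    by rewrite IHw // => /andP[-> ->]; rewrite eqxx.
  by exists s => //; rewrite IHw // ys.
- by apply/negbTE/norP; split; apply/mapP => -[].
rewrite /=; have [->|xv] := eqVneq x v.
  rewrite add1n eqSS -IHm orb_idl; last first.
    by move=> /mapP[y _ [/eqP]]; rewrite (negPf va).
  by apply/mapP/idP => [[y ys [->]]//|ys]; exists s.
rewrite add0n orb_idr; last by move=> /mapP[y _ [/eqP]]; rewrite (negPf xv).
rewrite eqseq_cons; apply/mapP/andP => [[y + [-> ->]]|[/andP[/eqP-> ys] cs]].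
  by rewrite IHw // => /andP[-> ->]; rewrite eqxx.
by exists s => //; rewrite IHw // ys.
Qed.

Lemma insertions_uniq v w m : v \notin w -> uniq (insertions v w m).
Proof.
have consI (a : nat) : injective (cons a) by move=> s t [].
elim: w m => [|a w IHw] m //; rewrite inE negb_or => /andP[va vw].
elim: m => [|m IHm]; rewrite insertions_cons.
  by rewrite cats0 map_inj_uniq ?IHw.
rewrite cat_uniq !map_inj_uniq ?IHw ?IHm // andbT.
by apply/hasPn => _ /mapP[y _ ->]; apply/mapP => -[z _ [/eqP]]; rewrite (negPf va).
Qed.

Section Insertion.
Local Open Scope ring_scope.
Context {R : comNzRingType}.

Definition word_stat (psi : nat -> nat -> nat -> nat -> R) (s : seq nat) : R :=
  psi (head 0%N s) (last 0%N s) (asc (head 0%N s) (behead s)) (des (head 0%N s) (behead s)).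

(** The sum of $\binom{p}{i} G(i,p-i)$ over i, where i of p similar gaps receive cards. Pascal's
    recursion treats one gap at a time, as [gap_sum] does. *)
Fixpoint bsum (p : nat) (G : nat -> nat -> R) : R :=
  if p is p'.+1 then bsum p' (fun i j => G i.+1 j) + bsum p' (fun i j => G i j.+1)
  else G 0%N 0%N.

Lemma eq_bsum p G H : (forall i j, G i j = H i j) -> bsum p G = bsum p H.
Proof. by elim: p G H => /= [|p IH] G H GH //; congr (_ + _); apply: IH. Qed.

Lemma bsumD p G H : bsum p (fun i j => G i j + H i j) = bsum p G + bsum p H.
Proof. by elim: p G H => /= [|p IH] G H //; rewrite !IH addrACA. Qed.

Lemma bsumE p G : bsum p G = \sum_(0 <= i < p.+1) 'C(p, i)%:R * G i (p - i)%N.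
Proof.
elim: p G => [|p IH] G /=; first by rewrite big_nat1 mul1r.
rewrite !IH [RHS]big_nat_recl // bin0 subn0 mul1r.
under [in RHS]eq_bigr do rewrite binS natrD mulrDl subSS.
rewrite big_split /= addrA [RHS]addrC; congr (_ + _).
rewrite big_nat_recl // bin0 mul1r subn0; congr (_ + _).
rewrite [RHS]big_nat_recr //= bin_small // mul0r addr0.
by apply: eq_big_nat => i /andP[_ ip]; rewrite subnSK.
Qed.

Context {v io : nat}.

(* io is 1 if v exceeds all the letters of the word, and 0 if v is neutral. *)
Definition below (b : nat) := (asc_pair b v == io) && (asc_pair v b == 0%N).

(* The sum over all sets of gaps of a :: w that receive copies of v, the gap before a
   excluded; om r is the weight of a set of r gaps. *)
Fixpoint gap_sum (om : nat -> R) (w : seq nat) (a : nat)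
    (phi : nat -> nat -> nat -> R) : R :=
  if w is b :: w' then
    gap_sum om w' b (fun y p d => phi y (asc_pair a b + p)%N (des_pair a b + d)%N)
    + gap_sum (om \o S) w' b (fun y p d => phi y (io + p)%N (io + d)%N)
  else om 0%N * phi a 0%N 0%N + om 1%N * phi v io 0%N.

Lemma eq_gap_sum om om' w a phi :
  om =1 om' -> gap_sum om w a phi = gap_sum om' w a phi.
Proof.
elim: w a om om' phi => [|b w IH] a om om' phi omE /=; first by rewrite !omE.
by congr (_ + _); apply: IH => // r; rewrite /= omE.
Qed.

Lemma gap_sumD om om' w a phi :
  gap_sum (fun r => om r + om' r) w a phi = gap_sum om w a phi + gap_sum om' w a phi.
Proof.
elim: w a om om' phi => [|b w IH] a om om' phi /=; first by ring.
by rewrite !IH addrACA; congr (_ + _ + (_ + _)).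
Qed.

Lemma gap_sum0 w a phi : gap_sum (fun=> 0) w a phi = 0.
Proof.
by elim: w a phi => [|b w IH] a phi /=; rewrite ?mul0r ?addr0 // !IH addr0.
Qed.

Let comp m (r : nat) : R := (compositions m r)%:R.

Let asc_pairvv : asc_pair v v = 0%N.
Proof. by rewrite /asc_pair ltnn. Qed.

(** One copy of v already stands in the gap before b, so m + 1 copies share this gap and r others.
    Leaving the gap towards b adds [io] falls. *)
Let sum_insertions_after b w m phi : below b ->
    (forall m phi, \sum_(s <- insertions v w m) phi (last b s) (asc b s) (des b s)
       = gap_sum (comp m) w b phi) ->
  \sum_(s <- insertions v (b :: w) m) phi (last v s) (asc v s) (des v s)
    = gap_sum (comp m.+1 \o S) w b (fun y p d => phi y p (io + d)%N).
Proof.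
move=> /andP[/eqP bv /eqP vb] IHw.
have step k : gap_sum (comp k) w b (fun y p d => phi y p (io + d)%N) =
    \sum_(s <- insertions v w k)
       phi (last b s) (asc_pair v b + asc b s)%N (des_pair v b + des b s)%N.
  rewrite -(IHw k (fun y p d => phi y p (io + d)%N)).
  by apply: eq_bigr => s _; rewrite /= vb /des_pair bv.
elim: m => [|m IHm]; rewrite insertions_cons big_cat /= big_map /= -step.
  rewrite big_nil addr0; apply: eq_gap_sum => r.
  by case: r => [|r]; rewrite /comp /= ?bin0.
rewrite big_map /=.
under [X in _ + X]eq_bigr do rewrite /des_pair asc_pairvv !add0n.
rewrite IHm -gap_sumD; apply: eq_gap_sum => r.
by have := compositionsS m.+1 r; rewrite /comp /= => ->; rewrite natrD.
Qed.

Lemma sum_insertions a w m phi : below a -> all below w ->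
  \sum_(s <- insertions v w m) phi (last a s) (asc a s) (des a s)
    = gap_sum (comp m) w a phi.
Proof.
elim: w a m phi => [|b w IHw] a m phi ba bw; have [/eqP av /eqP va] := andP ba.
  rewrite big_seq1 /=; case: m => [|m] /=.
    by rewrite /comp /= mul1r mul0r addr0.
  have [-> -> ->] : [/\ last v (nseq m v) = v, asc v (nseq m v) = 0%N
      & des v (nseq m v) = 0%N].
    by elim: m => //= m [-> -> ->]; rewrite /des_pair asc_pairvv.
  by rewrite /des_pair av va /comp /= mul0r bin0 mul1r add0r !addn0.
have [bb bw'] := andP bw.
have {}IHw := fun m phi => IHw b m phi bb bw'.
rewrite insertions_cons big_cat big_map /=.
rewrite (IHw m (fun y p d => phi y (asc_pair a b + p)%N (des_pair a b + d)%N)); congr (_ + _).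
case: m => [|m].
  rewrite big_nil (@eq_gap_sum _ (fun=> 0)) ?gap_sum0 //.
rewrite big_map /= -(sum_insertions_after _ (fun y p d => phi y (io + p)%N d)) //.
by apply: eq_bigr => s _; rewrite /des_pair av va.
Qed.

(** The gap in front of the word either stays empty or receives cards; in the latter case v becomes
    the first letter and the passage from v to a adds [io] falls. *)
Lemma sum_insertions_head a w m psi : below a -> all below w ->
  \sum_(s <- insertions v (a :: w) m) word_stat psi s
    = gap_sum (comp m) w a (psi a)
      + gap_sum (comp m \o S) w a (fun y p d => psi v y p (io + d)%N).
Proof.
move=> ba bw; rewrite insertions_cons big_cat big_map /= /word_stat /=.
rewrite (@sum_insertions a w m (psi a)) //; congr (_ + _); case: m => [|m].
  by rewrite big_nil (@eq_gap_sum _ (fun=> 0)) ?gap_sum0.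
rewrite big_map /= -(sum_insertions_after _ (psi v)) // => k phi.
exact: sum_insertions.
Qed.

(* Here i, j and k are the numbers of rises, falls and levels of a :: w that receive
   copies of v; the final gap adds the last two terms. *)
Lemma gap_sum_bsum om w a phi :
  gap_sum om w a phi =
    bsum (asc a w) (fun i p => bsum (des a w) (fun j d => bsum (lev a w) (fun k _ =>
      om (i + j + k)%N
        * phi (last a w) (io * (i + j + k) + p)%N (io * (i + j + k) + d)%N
      + om (i + j + k).+1
        * phi v (io * (i + j + k).+1 + p)%N (io * (i + j + k) + d)%N))).
Proof.
elim: w a om phi => [|b w IH] a om phi /=; first by rewrite muln0 muln1 !addn0.
rewrite !IH /des_pair.
have congr_term n n' y x1 x2 x3 x4 p d :
    n = n' -> x1 = (io * n + p)%N -> x2 = (io * n + d)%N -> x3 = (io * n.+1 + p)%N ->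
    x4 = (io * n + d)%N ->
    om n * phi y x1 x2 + om n.+1 * phi v x3 x4 =
    om n' * phi y (io * n' + p)%N (io * n' + d)%N
      + om n'.+1 * phi v (io * n'.+1 + p)%N (io * n' + d)%N.
  by move=> -> -> -> -> ->.
(* The gap between a and b unfolds one Pascal step in the [bsum] of its own kind and leaves the
   other two alone. *)
have [[ab ba]|[ab ba]|[ab ba]] : [\/ asc_pair a b = 1%N /\ asc_pair b a = 0%N,
   asc_pair a b = 0%N /\ asc_pair b a = 1%N | asc_pair a b = 0%N /\ asc_pair b a = 0%N].
- rewrite /asc_pair; case: (ltngtP a b); case: (b < 4)%N; case: (a < 4)%N => /=;
  by [constructor 1|constructor 2|constructor 3].
- rewrite ab ba /= [LHS]addrC; congr (_ + _); do 3![apply: eq_bsum => ? ?];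
    apply: congr_term; rewrite ?mulnS; lia.
- rewrite ab ba /= -[RHS]/(bsum _ _) bsumD [LHS]addrC.
  congr (_ + _); do 3![apply: eq_bsum => ? ?];
    apply: congr_term; rewrite ?mulnS; lia.
- rewrite ab ba /=.
  rewrite [LHS]addrC -bsumD; apply: eq_bsum => i p; rewrite -bsumD; apply: eq_bsum => j d.
  congr (_ + _); apply: eq_bsum => ? ?;
    apply: congr_term; rewrite ?mulnS; lia.
Qed.

(** The four terms are the cases that neither end, the back, the front or both ends receive copies
    of v; [om] is taken at the number of such ends. *)
Definition ends_sum (om : nat -> R) (psi : nat -> nat -> nat -> nat -> R)
    (f l p d : nat) : R :=
  om 0%N * psi f l p d + om 1%N * psi f v (io + p)%N d
  + om 1%N * psi v l p (io + d)%N + om 2%N * psi v v (io + p)%N (io + d)%N.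

(** A filled inner gap becomes [io] rises and [io] falls, whatever it was before; an empty one stays
    as it was. *)
Lemma sum_insertions_bsum a w m psi : below a -> all below w ->
  \sum_(s <- insertions v (a :: w) m) word_stat psi s =
    bsum (asc a w) (fun i p => bsum (des a w) (fun j d => bsum (lev a w) (fun k _ =>
      ends_sum (fun e => comp m (i + j + k + e)%N) psi a (last a w)
        (io * (i + j + k) + p)%N (io * (i + j + k) + d)%N))).
Proof.
move=> ba bw; rewrite sum_insertions_head // !gap_sum_bsum.
rewrite -bsumD; apply: eq_bsum => i p; rewrite -bsumD; apply: eq_bsum => j d.
rewrite -bsumD; apply: eq_bsum => k _.
by rewrite /ends_sum /= addrA addn0 addn1 addn2 mulnS !addnA.
Qed.
End Insertion.

(** * Tables of the four statistics *)

Fixpoint foldi {A T : Type} (g : A -> nat -> T -> A) (i : nat) (a : A) (l : seq T) : A :=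
  if l is x :: l' then foldi g i.+1 (g a i x) l' else a.

Fixpoint update {T : Type} (x0 : T) (g : T -> T) (i : nat) (l : seq T) : seq T :=
  match i, l with
  | 0, [::] => [:: g x0]
  | 0, x :: l' => g x :: l'
  | i'.+1, [::] => x0 :: update x0 g i' [::]
  | i'.+1, x :: l' => x :: update x0 g i' l'
  end.

Fixpoint next_row (x : N) (r : seq N) : seq N :=
  if r is y :: r' then N.add x y :: next_row y r' else [:: x].

Definition pascal_row n := iter n (next_row 0) [:: 1%num].

(** Rows 0 to 51 form a constant shared by all lookups. Beyond them [binN] computes the row afresh,
    so that it is correct for all arguments. *)
Definition pascal := [seq pascal_row n | n <- iota 0 52].

Definition binN (n k : nat) : N :=
  nth 0%num (if n < 52 then nth [::] pascal n else pascal_row n) k.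

Definition compositionsN (m r : nat) : N :=
  match m, r with
  | 0, 0 => 1%num
  | m'.+1, r'.+1 => binN m' r'
  | _, _ => 0%num
  end.

Lemma nat_of_add_bin m n : N.add m n = m + n :> nat.
Proof. lia. Qed.

Lemma nat_of_mul_bin m n : N.mul m n = m * n :> nat.
Proof. lia. Qed.

Lemma nth_next_row x r k :
  nth 0%num (next_row x r) k = N.add (nth 0%num (x :: r) k) (nth 0%num r k).
Proof.
elim: r x k => [|y r IH] x [|k] /=.
- by rewrite N.add_0_r.
- by rewrite !nth_nil.
- by [].
exact: IH.
Qed.

Lemma binNE n k : binN n k = 'C(n, k) :> nat.
Proof.
have -> : binN n k = nth 0%num (pascal_row n) k.
  by rewrite /binN; case: ifP => // n52; rewrite (nth_map 0) ?size_iota // nth_iota.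
elim: n k => [|n IH] [|k] //.
- by rewrite /= nth_nil.
- by rewrite /= nth_next_row nat_of_add_bin IH !bin0.
by rewrite /= nth_next_row nat_of_add_bin !IH binS addnC.
Qed.

Lemma compositionsNE m r : compositionsN m r = compositions m r :> nat.
Proof. by case: m r => [|m] [|r] //=; rewrite binNE. Qed.

Section IndexedSums.
Local Open Scope ring_scope.
Context {V : nmodType}.

Lemma foldl_sum (A I : Type) (val : A -> V) (delta : I -> V)
    (g : A -> I -> A) (s : seq I) (a : A) :
  (forall a i, val (g a i) = val a + delta i) ->
  val (foldl g a s) = val a + \sum_(i <- s) delta i.
Proof.
move=> gE; elim: s a => [|i s IH] a /=; first by rewrite big_nil addr0.
by rewrite IH gE big_cons addrA.
Qed.

Fixpoint isum {T : Type} (F : nat -> T -> V) (i : nat) (l : seq T) : V :=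
  if l is x :: l' then F i x + isum F i.+1 l' else 0.

Lemma eq_isum T (F G : nat -> T -> V) i l :
  (forall i x, F i x = G i x) -> isum F i l = isum G i l.
Proof. by move=> FG; elim: l i => //= x l IH i; rewrite FG IH. Qed.

Lemma isumD T (F G : nat -> T -> V) i l :
  isum (fun i x => F i x + G i x) i l = isum F i l + isum G i l.
Proof. by elim: l i => /= [|x l IH] i; rewrite ?addr0 // IH addrACA. Qed.

Lemma isum_update T (F : nat -> T -> V) x0 g i k l delta :
  (forall j, F j x0 = 0) -> (forall x, F (k + i)%N (g x) = F (k + i)%N x + delta) ->
  isum F k (update x0 g i l) = isum F k l + delta.
Proof.
move=> F0; elim: i k l => [|i IH] k [|x l] /=; rewrite ?addn0 => Fg.
- by rewrite Fg F0 addr0.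
- by rewrite Fg addrAC.
- by rewrite F0 !add0r IH => [|x]; rewrite ?addSnnS //= add0r.
by rewrite IH ?addrA // => y; rewrite addSnnS.
Qed.

Lemma foldi_isum A T (val : A -> V) (F : nat -> T -> V) g k a l :
  (forall a i x, val (g a i x) = val a + F i x) ->
  val (foldi g k a l) = val a + isum F k l.
Proof.
move=> gE; elim: l k a => [|x l IH] k a /=; first by rewrite addr0.
by rewrite IH gE addrA.
Qed.

End IndexedSums.

Section Tables.
Local Open Scope ring_scope.
Context {R : comNzRingType}.

Definition nr (n : N) : R := (nat_of_bin n)%:R.

Lemma nrD m n : nr (N.add m n) = nr m + nr n.
Proof. by rewrite /nr nat_of_add_bin natrD. Qed.

Lemma nrM m n : nr (N.mul m n) = nr m * nr n.
Proof. by rewrite /nr nat_of_mul_bin natrM. Qed.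

(* The entry at f, l, p, d counts the words with first letter f, last letter l,
   p rises and d falls. *)
Definition table := seq (seq (seq (seq N))).

Definition tsum (t : table) (psi : nat -> nat -> nat -> nat -> R) : R :=
  isum (fun f => isum (fun l => isum (fun p => isum (fun d n =>
    nr n * psi f l p d) 0) 0) 0) 0 t.

Definition push (t : table) (f l p d : nat) (n : N) : table :=
  if n is N0 then t else
  update [::] (update [::] (update [::] (update 0%num (N.add n) d) p) l) f t.

Lemma tsum_push t f l p d n psi :
  tsum (push t f l p d n) psi = tsum t psi + nr n * psi f l p d.
Proof.
case: n => [|n]; first by rewrite /nr mul0r addr0.
rewrite /tsum; apply: isum_update => // a; apply: isum_update => // b.
apply: isum_update => // e; apply: isum_update => [j|x]; first by rewrite /nr mul0r.
by rewrite nrD mulrDl addrC.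
Qed.

Definition fold_states {A : Type} (g : A -> nat -> nat -> nat -> nat -> N -> A)
    (a : A) (t : table) : A :=
  foldi (fun a f => foldi (fun a l => foldi (fun a p => foldi (fun a d n =>
    g a f l p d n) 0 a) 0 a) 0 a) 0 a t.

Lemma fold_states_sum A (val : A -> R) g a t psi :
  (forall a f l p d n, val (g a f l p d n) = val a + nr n * psi f l p d) ->
  val (fold_states g a t) = val a + tsum t psi.
Proof. by move=> gE; do 4![apply: foldi_isum => *]; apply: gE. Qed.

Lemma tsumD t psi psi' :
  tsum t (fun f l p d => psi f l p d + psi' f l p d) = tsum t psi + tsum t psi'.
Proof.
rewrite /tsum -isumD; apply: eq_isum => ? ?; rewrite -isumD; apply: eq_isum => ? ?.
rewrite -isumD; apply: eq_isum => ? ?; rewrite -isumD; apply: eq_isum => ? ?.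
exact: mulrDr.
Qed.

Definition push_ends (v io : nat) (w : nat -> N) c f l p d (t : table) : table :=
  let t := push t f l p d (N.mul c (w 0%N)) in
  let c1 := N.mul c (w 1%N) in
  let t := push t f v (io + p) d c1 in
  let t := push t v l p (io + d) c1 in
  push t v v (io + p) (io + d) (N.mul c (w 2)).

Lemma tsum_push_ends v io w c f l p d t psi :
  tsum (push_ends v io w c f l p d t) psi =
    tsum t psi + nr c * ends_sum (v := v) (io := io) (fun e => nr (w e)) psi f l p d.
Proof. rewrite !tsum_push !nrM /ends_sum; ring. Qed.

(** Of sz inner gaps, sz - p - d are levels. The loops choose i rises, j falls and k levels to fill,
    and each stops at m because m cards fill at most m gaps. *)
Definition insert_max (v m sz : nat) (t : table) : table :=
  fold_states (fun t f l p d n =>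
    foldl (fun t i => foldl (fun t j => foldl (fun t k =>
      let q := (i + j + k)%N in
      if (q <= m)%N then
        push_ends v 1 (fun e => compositionsN m (q + e))
          (N.mul n (N.mul (binN p i) (N.mul (binN d j) (binN (sz - p - d) k))))
          f l (q + (p - i)) (q + (d - j)) t
      else t)
    t (index_iota 0 (minn (sz - p - d) m).+1)) t (index_iota 0 (minn d m).+1))
    t (index_iota 0 (minn p m).+1)) [::] t.

Lemma big_nat_minn p m (F : nat -> R) : (forall i, (m < i)%N -> F i = 0) ->
  \sum_(0 <= i < p.+1) F i = \sum_(0 <= i < (minn p m).+1) F i.
Proof.
move=> F0; rewrite (big_cat_nat (n := (minn p m).+1)) ?ltnS ?geq_minl //=.
rewrite [X in _ + X]big_nat_cond [X in _ + X]big1 ?addr0 // => i.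
rewrite andbT => /andP[mi ip]; apply: F0; lia.
Qed.

Lemma tsum_insert_max v m sz t psi :
  tsum (insert_max v m sz t) psi = tsum t (fun f l p d =>
    bsum p (fun i p' => bsum d (fun j d' => bsum (sz - p - d) (fun k _ =>
      ends_sum (v := v) (io := 1) (fun e => (compositions m (i + j + k + e))%:R) psi f l
        (i + j + k + p')%N (i + j + k + d')%N)))).
Proof.
rewrite /insert_max.
rewrite (@fold_states_sum _ (tsum^~ psi) _ _ _ (fun f l p d =>
    bsum p (fun i p' => bsum d (fun j d' => bsum (sz - p - d) (fun k _ =>
      ends_sum (v := v) (io := 1) (fun e => (compositions m (i + j + k + e))%:R) psi f l
        (i + j + k + p')%N (i + j + k + d')%N))))); first by rewrite /tsum /= add0r.
move=> {t} a f l p d n.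
pose E i j k p' d' := ends_sum (R := R) (v := v) (io := 1)
  (fun e => (compositions m (i + j + k + e))%:R) psi f l (i + j + k + p')%N (i + j + k + d')%N.
(* This justifies both the truncated ranges and the test [q <= m]. *)
have E0 i j k p' d' : (m < i + j + k)%N -> E i j k p' d' = 0.
  move=> mijk; have c0 e : compositions m (i + j + k + e) = 0%N.
    by apply: compositions_small; lia.
  by rewrite /E /ends_sum !c0 !mul0r !addr0.
rewrite -/(E).
have -> : bsum p (fun i p' => bsum d (fun j d' => bsum (sz - p - d) (fun k _ => E i j k p' d'))) =
  \sum_(0 <= i < (minn p m).+1) \sum_(0 <= j < (minn d m).+1)
    \sum_(0 <= k < (minn (sz - p - d) m).+1)
      'C(p, i)%:R * ('C(d, j)%:R * ('C(sz - p - d, k)%:R * E i j k (p - i)%N (d - j)%N)).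
  rewrite bsumE; under eq_bigr do rewrite bsumE.
  under eq_bigr do under eq_bigr do rewrite bsumE.
  rewrite (@big_nat_minn _ m) => [|i mi]; last first.
    rewrite big1 ?mulr0 // => j _; rewrite big1 ?mulr0 // => k _.
    by rewrite E0 ?mulr0 //; lia.
  apply: eq_bigr => i _; rewrite (@big_nat_minn _ m) => [|j mj]; last first.
    by rewrite big1 ?mulr0 // => k _; rewrite E0 ?mulr0 //; lia.
  rewrite mulr_sumr; apply: eq_bigr => j _; rewrite (@big_nat_minn _ m) => [|k mk]; last first.
    by rewrite E0 ?mulr0 //; lia.
  by rewrite !mulr_sumr.
rewrite mulr_sumr; apply: foldl_sum => {}a i.
rewrite mulr_sumr; apply: foldl_sum => {}a j.
rewrite mulr_sumr; apply: foldl_sum => {}a k.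
have step : tsum (push_ends v 1 (fun e => compositionsN m (i + j + k + e))
      (N.mul n (N.mul (binN p i) (N.mul (binN d j) (binN (sz - p - d) k))))
      f l (i + j + k + (p - i)) (i + j + k + (d - j)) a) psi = tsum a psi +
    nr n * ('C(p, i)%:R * ('C(d, j)%:R * ('C(sz - p - d, k)%:R * E i j k (p - i)%N (d - j)%N))).
  rewrite tsum_push_ends !nrM /nr !binNE -!mulrA; congr (_ + _ * (_ * (_ * (_ * _)))).
  by rewrite /ends_sum !compositionsNE.
rewrite /=; case: leqP => [_|mijk]; first exact: step.
by rewrite E0 // !mulr0 addr0.
Qed.

Fixpoint vadd (u v : seq N) : seq N :=
  match u, v with
  | [::], _ => v
  | _, [::] => u
  | x :: u', y :: v' => N.add x y :: vadd u' v'
  end.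

Definition vsum (v : seq N) (chi : nat -> R) : R := isum (fun i n => nr n * chi i) 0 v.

Lemma vsum_vadd u v chi : vsum (vadd u v) chi = vsum u chi + vsum v chi.
Proof.
rewrite /vsum; elim: u v 0%N => [|x u IH] [|y v] k /=; rewrite ?add0r ?addr0 //.
by rewrite IH nrD mulrDl addrACA.
Qed.

Lemma vsum_scale c v chi : vsum (map (N.mul c) v) chi = nr c * vsum v chi.
Proof.
rewrite /vsum; elim: v 0%N => [|x v IH] k /=; first by rewrite mulr0.
by rewrite IH nrM mulrDr mulrA.
Qed.

(** For m > 0, the number of ways to share m cards among r gaps that must be filled and l gaps that
    may stay empty. *)
Definition free_compositionsN (m l r : nat) : N :=
  if (r + l)%N is t.+1 then binN (m.-1 + l) t else 0%num.

(* Vandermonde's identity *)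
Lemma bsum_compositions m l r : (0 < m)%N ->
  bsum l (fun k _ => (compositions m (r + k))%:R) = nr (free_compositionsN m l r).
Proof.
case: m => // m _; elim: l r => [|l IH] r.
  by rewrite /= /nr /free_compositionsN !addn0; case: r => //= r; rewrite binNE.
transitivity (bsum l (fun k _ => (compositions m.+1 (r.+1 + k))%:R : R)
              + bsum l (fun k _ => (compositions m.+1 (r + k))%:R)).
  by congr (_ + _); apply: eq_bsum => k _; rewrite addSnnS.
rewrite !IH /free_compositionsN /nr addnS addSn /=.
by case: (r + l)%N => [|t]; rewrite !binNE addnS ?binS ?bin0 -?natrD 1?addnC.
Qed.

(* For a word with p rises, d falls and sz gaps, e of whose two ends receive neutral
   cards: the number of ways of inserting m of them, listed by the number of remaining
   rises minus that of remaining falls, shifted by sz. *)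
Definition cut_vec (m sz p d e : nat) : seq N :=
  foldl (fun u i => foldl (fun u j =>
    update 0%num (N.add (N.mul (binN p i) (N.mul (binN d j)
      (free_compositionsN m (sz - p - d) (i + j + e))))) (p - i + (sz - (d - j))) u)
    u (index_iota 0 d.+1)) [::] (index_iota 0 p.+1).

(** Neutral cards in a level change no statistic, so the choice of the levels enters only through a
    count, which [bsum_compositions] evaluates. *)
Lemma vsum_cut_vec m sz p d e chi : (0 < m)%N ->
  vsum (cut_vec m sz p d e) chi =
    bsum p (fun i p' => bsum d (fun j d' => bsum (sz - p - d) (fun k _ =>
      (compositions m (i + j + k + e))%:R * chi (p' + (sz - d'))%N))).
Proof.
move=> m0; rewrite /cut_vec.
rewrite (@foldl_sum _ _ _ (vsum^~ chi) (fun i => 'C(p, i)%:R *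
  bsum d (fun j d' => bsum (sz - p - d) (fun k _ =>
      (compositions m (i + j + k + e))%:R * chi (p - i + (sz - d'))%N)))).
  by rewrite add0r bsumE.
move=> u i; rewrite bsumE mulr_sumr; apply: foldl_sum => {}u j.
rewrite /vsum (@isum_update _ _ _ _ _ _ _ _ ('C(p, i)%:R * ('C(d, j)%:R *
  (nr (free_compositionsN m (sz - p - d) (i + j + e)) * chi (p - i + (sz - (d - j)))%N)))) //.
- congr (_ + _ * (_ * _)); rewrite -bsum_compositions // !bsumE mulr_suml.
  by apply: eq_bigr => k _; rewrite mulrA addnAC.
- by move=> k; rewrite /nr mul0r.
by move=> x; rewrite nrD !nrM mulrDl addrC add0n -!mulrA /nr !binNE.
Qed.
End Tables.

(** * Rearrangements of a word and the tables that count them *)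

Definition insert_words (v m : nat) (L : seq (seq nat)) : seq (seq nat) :=
  [seq s | w <- L, s <- insertions v w m].

Definition arrangements (s0 : seq nat) (L : seq (seq nat)) :=
  uniq L /\ forall s, (s \in L) = perm_eq s s0.

(** Erasing v recovers the word into which the copies were inserted, so no result arises from two
    different words. *)
Lemma arrangements_insert v m s0 L : v \notin s0 ->
  arrangements s0 L -> arrangements (s0 ++ nseq m v) (insert_words v m L).
Proof.
move=> vs0 [uL memL].
have notin w : w \in L -> v \notin w by rewrite memL => /perm_mem ->.
split=> [|s].
  apply: allpairs_uniq_dep => // [w /notin|]; first exact: insertions_uniq.
  move=> _ _ /allpairsPdep[w1 [s1 [w1L s1w ->]]] /allpairsPdep[w2 [s2 [w2L s2w ->]]] /= s12.
  move: s1w s2w; rewrite !insertions_notin ?notin // -s12 => /andP[/eqP <- _] /andP[/eqP e _].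
  by rewrite -e.
have -> : (s \in insert_words v m L) = ([seq x <- s | x != v] \in L) && (count_mem v s == m).
  apply/allpairsPdep/andP => [[w [s' [wL + ->]]]|[sL sm]].
    by rewrite insertions_notin ?notin // => /andP[/eqP-> ->].
  exists [seq x <- s | x != v], s; split=> //.
  by rewrite insertions_notin ?eqxx // mem_filter eqxx.
rewrite memL.
have fs0 : [seq x <- s0 | x != v] = s0.
  by apply/all_filterP/allP => x xs0; apply: contraNneq vs0 => <-.
apply/andP/idP => [[ps /eqP <-]|ps].
  rewrite -(perm_filterC (fun x => x != v) s) perm_cat //.
  have -> : [seq x <- s | predC (fun x => x != v) x] = [seq x <- s | pred1 v x].
    by apply: eq_filter => x /=; rewrite negbK.
  by rewrite (all_pred1P _ _ (filter_all (pred1 v) s)) size_filter.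
split.
  have := perm_filter (fun x => x != v) ps.
  by rewrite filter_cat fs0 filter_nseq eqxx /= cats0.
have /seq.permP -> := ps; rewrite count_cat count_nseq /= eqxx mul1n.
by rewrite (count_memPn vs0).
Qed.

Section Evaluation.
Local Open Scope ring_scope.
Context {R : comNzRingType}.

Lemma sum_insert_words v m L (F : seq nat -> R) :
  \sum_(s <- insert_words v m L) F s = \sum_(w <- L) \sum_(s <- insertions v w m) F s.
Proof. by rewrite /insert_words big_allpairs_dep. Qed.

Definition tabulates (L : seq (seq nat)) (t : table) :=
  forall psi, \sum_(w <- L) word_stat psi w = tsum (R := R) t psi.

Lemma tabulates_insert_max v m sz s0 L t : (v < 4)%N -> size s0 = sz.+1 ->
  all (fun b => b < v)%N s0 -> arrangements s0 L -> tabulates L t ->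
  tabulates (insert_words v m L) (insert_max v m sz t).
Proof.
move=> v4 ss0 s0v [_ memL] Lt psi.
rewrite tsum_insert_max sum_insert_words -Lt; apply: eq_big_seq => w.
rewrite memL => pw; move: (perm_size pw) (perm_all (fun b => b < v)%N pw).
rewrite ss0 s0v; case: w {pw} => // a w [sw] /= /andP[av wv].
have below_lt b : (b < v)%N -> below (v := v) (io := 1) b.
  by move=> bv; rewrite /below /asc_pair bv v4 ltnNge ltnW.
rewrite (sum_insertions_bsum (io := 1)) ?below_lt //; last first.
  by apply/allP => b /(allP wv); apply: below_lt.
rewrite /word_stat /=.
have -> : lev a w = (sz - asc a w - des a w)%N by rewrite -sw -(asc_des_lev a w); lia.
apply: eq_bsum => i p; apply: eq_bsum => j d; apply: eq_bsum => k _.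
by rewrite !mul1n.
Qed.

(** Neutral cards at one end hide the letter there, which v replaces. States that become equal are
    merged before the inner gaps are treated. *)
Definition marginal1 (v : nat) (t : table) : table :=
  fold_states (fun t f l p d n => push (push t v l p d n) f v p d n) [::] t.

Definition marginal2 (v : nat) (t : table) : table :=
  fold_states (fun t f l p d n => push t v v p d n) [::] t.

Lemma tsum_marginal1 v t psi : tsum (R := R) (marginal1 v t) psi =
  tsum t (fun f l p d => psi v l p d + psi f v p d).
Proof.
rewrite (@fold_states_sum _ _ (tsum^~ psi) _ _ _ (fun f l p d => psi v l p d + psi f v p d)).
  by rewrite add0r.
by move=> *; rewrite !tsum_push mulrDr addrA.
Qed.

Lemma tsum_marginal2 v t psi : tsum (R := R) (marginal2 v t) psi =
  tsum t (fun f l p d => psi v v p d).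
Proof.
rewrite (@fold_states_sum _ _ (tsum^~ psi) _ _ _ (fun f l p d => psi v v p d)).
  by rewrite add0r.
by move=> *; rewrite tsum_push.
Qed.

Definition rsum (r : seq (seq (seq N))) (chi : nat -> nat -> nat -> R) : R :=
  isum (fun f => isum (fun l v => vsum v (chi f l)) 0) 0 r.

Definition cut_step (cutv : nat -> nat -> nat -> seq N) (e : nat) (t : table)
    (r : seq (seq (seq N))) :=
  fold_states (fun r f l p d n =>
    if n is N0 then r else
    update [::] (update [::] (vadd (map (N.mul n) (cutv p d e))) l) f r) r t.

Lemma rsum_cut_step cutv e t r chi : rsum (cut_step cutv e t r) chi =
  rsum r chi + tsum t (fun f l p d => vsum (cutv p d e) (chi f l)).
Proof.
apply: (@fold_states_sum _ _ (rsum^~ chi)) => {}r f l p d [|n].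
  by rewrite /nr mul0r addr0.
apply: isum_update => // w; apply: isum_update => // u.
by rewrite vsum_vadd vsum_scale addrC.
Qed.

Definition insert_neutral (cutv : nat -> nat -> nat -> seq N) (v : nat) (t : table) :=
  cut_step cutv 2 (marginal2 v t) (cut_step cutv 1 (marginal1 v t) (cut_step cutv 0 t [::])).

(** The cases of 0, 1 and 2 ends covered by neutral cards are added. Of p and d only the difference
    matters from here on; it is stored as p + (sz - d), where d <= sz keeps the subtraction
    exact. *)
Lemma sum_insert_neutral cutv m sz s0 L t (psi : nat -> nat -> nat -> nat -> R) chi :
  (0 < m)%N -> (forall p d e, cutv p d e = cut_vec m sz p d e) ->
  size s0 = sz.+1 -> all (fun b => b < 4)%N s0 -> arrangements s0 L -> tabulates L t ->
  (forall f l p d, (d <= sz)%N -> psi f l p d = chi f l (p + (sz - d))%N) ->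
  \sum_(s <- insert_words 4 m L) word_stat psi s = rsum (insert_neutral cutv 4 t) chi.
Proof.
move=> m0 cutvE ss0 s0v [_ memL] Lt psichi.
rewrite !rsum_cut_step add0r tsum_marginal1 tsum_marginal2 -!tsumD -Lt sum_insert_words.
apply: eq_big_seq => w.
rewrite memL => pw; move: (perm_size pw) (perm_all (fun b => b < 4)%N pw).
rewrite ss0 s0v; case: w {pw} => // a w [sw] /= /andP[av wv].
have below_lt b : (b < 4)%N -> below (v := 4) (io := 0) b.
  by move=> bv; rewrite /below /asc_pair /= andbF ltnNge ltnW.
rewrite (sum_insertions_bsum (io := 0)) ?below_lt //; last first.
  by apply/allP => b /(allP wv); apply: below_lt.
rewrite /word_stat /= !cutvE !vsum_cut_vec //.
have -> : lev a w = (sz - asc a w - des a w)%N by rewrite -sw -(asc_des_lev a w); lia.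
have dsz : (des a w <= sz)%N by rewrite -sw -(asc_des_lev a w); lia.
rewrite -!bsumD !bsumE; apply: eq_bigr => i _; congr (_ * _).
rewrite -!bsumD !bsumE; apply: eq_bigr => j _; congr (_ * _).
rewrite -!bsumD; apply: eq_bsum => k _.
rewrite /ends_sum !mul0n !add0n !psichi; try by lia.
ring.
Qed.

End Evaluation.

(** * The computation for the poker deck *)

Delimit Scope Z_scope with BZ.

(** The vectors do not depend on the end letters, so they are tabulated in advance. The ranges cover
    p + d <= 19, the number of inner gaps of a word of 20 letters. *)
Definition cut_table : seq (seq (seq (seq N))) :=
  [seq [seq [seq cut_vec 32 19 p d e | e <- iota 0 3] | d <- iota 0 (20 - p)] | p <- iota 0 20].

Definition cut_lookup (p d e : nat) : seq N :=
  if [&& p < 20, d < 20 - p & e < 3]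
  then nth [::] (nth [::] (nth [::] cut_table p) d) e else cut_vec 32 19 p d e.

Lemma cut_lookupE p d e : cut_lookup p d e = cut_vec 32 19 p d e.
Proof.
rewrite /cut_lookup; case: ifP => // /and3P[p20 dp e3].
by rewrite !(nth_map 0) ?size_iota // !nth_iota.
Qed.

(** The start is the word 00000, the only one with five equal letters 0; the numbers 4, 9 and 14
    count the inner gaps of words of 5, 10 and 15 letters. *)
Definition letter_table : table :=
  insert_max 3 5 14 (insert_max 2 5 9 (insert_max 1 5 4 (push [::] 0 0 0 0 1%num))).

Definition deck_table : seq (seq (seq N)) := insert_neutral cut_lookup 4 letter_table.

Fixpoint zsum {T : Type} (F : nat -> T -> Z) (i : nat) (l : seq T) : Z :=
  if l is x :: l' then Z.add (F i x) (zsum F i.+1 l') else 0%BZ.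

Definition rsumZ (r : seq (seq (seq N))) (chi : nat -> nat -> nat -> Z) : Z :=
  zsum (fun f => zsum (fun l => zsum (fun i n => Z.mul (chi f l i) (Z.of_N n)) 0) 0) 0 r.

Fixpoint count_pairs (u v : nat) (s : seq nat) : nat :=
  if s is a :: s' then (if a == u then count_mem v s' else 0) + count_pairs u v s' else 0.

Definition pair_excess (u v : nat) (s : seq nat) : Z :=
  Z.sub (Z.of_nat (count_pairs u v s)) (Z.of_nat (count_pairs v u s)).

Definition poker_seq : seq nat := flatten (nseq 5 (iota 0 4)) ++ nseq 32 4.

Definition cut_seq (m : nat) : seq nat := iter m (rotr 1) poker_seq.

(* In units of 1/160, so that a rise counts 32, that is 1/5. The index i is shifted by
   19, the number of inner gaps in a word of 20 letters. *)
Definition score (z : seq Z) (f l i : nat) : Z :=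
  Z.abs (Z.add (Z.mul 32%BZ (Z.sub (Z.of_nat i) 19%BZ)) (Z.sub (nth 0%BZ z f) (nth 0%BZ z l))).

(** The potential z. Against the neutral value 4 there are no rises or falls, and 5 times 32 is the
    unit 160, so z(u) - z(4) must be Z(D',u,4) for u < 4; here z(4) = 0. *)
Definition excess_seq (m : nat) : seq Z := [seq pair_excess u 4 (cut_seq m) | u <- iota 0 5].

Definition total_score (r : seq (seq (seq N))) (m : nat) : Z :=
  rsumZ r (score (excess_seq m)).

Definition multiplicity (u : nat) : Z := if u < 4 then 5%BZ else 32%BZ.

(** The splitting of 160 Z(D',u,v) / (n_u n_v) into 32 times a sign plus z(u) - z(v), cleared of
    denominators. *)
Definition excess_check (m : nat) : bool :=
  let s := cut_seq m in let z := excess_seq m in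
  all (fun u => all (fun v =>
    Z.eqb (Z.mul 160%BZ (pair_excess u v s))
      (Z.mul (Z.mul (multiplicity u) (multiplicity v))
        (Z.add (Z.mul 32%BZ (Z.sub (Z.of_nat (asc_pair u v)) (Z.of_nat (asc_pair v u))))
          (Z.sub (nth 0%BZ z u) (nth 0%BZ z v))))) (iota 0 5)) (iota 0 5).

(** With t = N, the number of reorderings, a cut of total score s has the value 1/2 · 52/(2N) ·
    s/160 = 13 s / (160 N). *)
Definition kappa_check (r : seq (seq (seq N))) : bool :=
  let t := rsumZ r (fun _ _ _ => 1%BZ) in
  let s16 := total_score r 16 in
  [&& Z.ltb 0%BZ t,
      Z.eqb (13 * total_score r 0 * 123600572196960202344)%BZ
            (160 * t * 1041539930128654272599)%BZ,
      Z.eqb (13 * s16 * 126685078454994859800)%BZ (160 * t * 523485619699747366033)%BZ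
    & all (fun m => Z.leb s16 (total_score r m)) (iota 0 52)].

Lemma kappa_checkP : kappa_check deck_table = true.
Proof. vm_compute; reflexivity. Qed.

Lemma excess_checkP : all excess_check (iota 0 52) = true.
Proof. vm_compute; reflexivity. Qed.

(** * Decks as words *)

Section Words.
Context {n k : nat}.
Implicit Type D : deck n 'I_k.

Definition word D : seq nat := [seq val (D i) | i <- enum 'I_n].

Lemma size_word D : size (word D) = n.
Proof. by rewrite size_map size_enum_ord. Qed.

Lemma nth_word D (i : 'I_n) : nth 0 (word D) i = D i.
Proof. by rewrite (nth_map i) ?size_enum_ord // nth_ord_enum. Qed.

Lemma word_inj : injective word.
Proof.
move=> D E DE; apply/ffunP => i; apply: val_inj.
by rewrite /= -!nth_word DE.
Qed.

Lemma word_permute D (p : 'S_n) : perm_eq (word (permute_deck p D)) (word D).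
Proof.
have -> : word (permute_deck p D) = [seq val (D i) | i <- [seq (p^-1)%g i | i <- enum 'I_n]].
  by rewrite -map_comp; apply: eq_map => i /=; rewrite ffunE.
apply: perm_map; apply: uniq_perm => [||i].
- by rewrite (map_inj_uniq perm_inj) enum_uniq.
- exact: enum_uniq.
rewrite mem_enum; apply/mapP; exists (p i); rewrite ?mem_enum //.
by rewrite permK.
Qed.

Lemma perm_eq_wordP D s : perm_eq s (word D) -> exists p : 'S_n, s = word (permute_deck p D).
Proof.
move=> sD; have szD : size (word D) == n by rewrite size_word.
have /tuple_permP[p sE] : perm_eq s (Tuple szD) by [].
(* [tuple_permP] reads the word through p, whereas [permute_deck] reads the deck through the
   inverse. *)
exists (p^-1)%g; rewrite sE /word /=; apply: eq_map => i.
by rewrite ffunE invgK (tnth_nth 0) /= nth_word.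
Qed.

(** Distinct decks have distinct words, and the words of the reorderings are exactly the
    rearrangements of [word D]. *)
Lemma sum_reorderings (V : nmodType) D (L : seq (seq nat)) (F : seq nat -> V) :
  arrangements (word D) L ->
  (\sum_(E in reorderings D) F (word E) = \sum_(s <- L) F s)%R.
Proof.
move=> [uL memL]; rewrite -big_enum /= -(big_map word predT) /=.
apply: perm_big; apply: uniq_perm => //.
  by rewrite map_inj_uniq ?enum_uniq //; exact: word_inj.
move=> s; rewrite memL; apply/mapP/idP => [[E]|/perm_eq_wordP[p ->]].
  by rewrite mem_enum => /imsetP[p _ ->] ->; apply: word_permute.
by exists (permute_deck p D); rewrite // mem_enum; apply/imsetP; exists p.
Qed.

Lemma num_value_word D v : num_value D v = count_mem (val v) (word D).
Proof.
rewrite /num_value cardsE -sum1_card -sum1_count big_map big_enum_cond.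
by apply: eq_bigl => i; rewrite unfold_in.
Qed.

Lemma pairs_word D u v : #|pairs D u v| = count_pairs (val u) (val v) (word D).
Proof.
have count_pairsE a b s : count_pairs a b s = \sum_(i < size s) \sum_(j < size s)
    [&& i < j, nth 0 s i == a & nth 0 s j == b].
  elim: s => [|c s IH]; first by rewrite big_ord0.
  rewrite /= big_ord_recl big_ord_recl /= add0n; congr (_ + _).
    case: (c == a) => /=; last by rewrite big1.
    rewrite -sum1_count (big_nth 0) big_mkord big_mkcond /=.
    by apply: eq_bigr => j _; case: eqP.
  rewrite IH; apply: eq_bigr => i _; rewrite big_ord_recl /= add0n.
  by apply: eq_bigr => j _; rewrite /bump /= !add1n !add0n ltnS.
rewrite count_pairsE size_word pair_bigA /= -sum1_card big_mkcond /=.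
by apply: eq_bigr => -[i j] _; rewrite !nth_word inE /= !val_eqE; case: ifP.
Qed.

End Words.

(** * Sums along the consecutive cards of a deck *)

Section AdjacentSum.
Context {R : comNzRingType}.
Local Open Scope ring_scope.

Fixpoint adjacent_sum (F : nat -> nat -> R) (a : nat) (s : seq nat) : R :=
  if s is b :: s' then F a b + adjacent_sum F b s' else 0.

Lemma adjacent_sum_nth F a s :
  adjacent_sum F a s = \sum_(i < size s) F (nth 0%N (a :: s) i) (nth 0%N s i).
Proof.
elim: s a => [|b s IH] a /=; first by rewrite big_ord0.
by rewrite big_ord_recl IH.
Qed.

(** The coboundary z(a) - z(b) telescopes along the word and leaves only its two ends. *)
Lemma adjacent_sum_asc_des (N : nat) (c : R) (z : nat -> R) F a s :
  (forall a b, (a < N)%N -> (b < N)%N ->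
     F a b = c * ((asc_pair a b)%:R - (asc_pair b a)%:R) + (z a - z b)) ->
  (a < N)%N -> all (fun b => b < N)%N s ->
  adjacent_sum F a s = c * ((asc a s)%:R - (des a s)%:R) + (z a - z (last a s)).
Proof.
move=> FE; elim: s a => [|b s IH] a aN /=; first by rewrite !subrr mulr0 addr0.
by move=> /andP[bN sN]; rewrite FE // IH // !natrD /des_pair; ring.
Qed.
End AdjacentSum.

Section Deck.
Local Open Scope ring_scope.

Lemma sum_digraphs (n k : nat) (D : deck n 'I_k) (F : nat -> nat -> rat) :
  \sum_u \sum_v #|digraphs D u v|%:R * F (val u) (val v) =
  adjacent_sum F (head 0%N (word D)) (behead (word D)).
Proof.
pose adj (ij : 'I_n * 'I_n) := ij.2 == ij.1.+1 :> nat.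
transitivity (\sum_(ij | adj ij) F (D ij.1) (D ij.2)).
  under eq_bigr do under eq_bigr do rewrite -sum1_card natr_sum mulr_suml.
  under eq_bigr do under eq_bigr do under eq_bigr do rewrite mul1r.
  rewrite pair_bigA /=.
  rewrite (partition_big (fun ij => (D ij.1, D ij.2)) predT) //=.
  apply: eq_bigr => -[u v] _ /=; apply: congr_big => // ij.
    by rewrite inE xpair_eqE.
  by rewrite inE => /and3P[_ /eqP -> /eqP ->].
rewrite adjacent_sum_nth /adj.
rewrite -(pair_big_dep predT (fun i j : 'I_n => j == i.+1 :> nat)
  (fun i j => F (D i) (D j))) /=.
under eq_bigr do under eq_bigr do rewrite -!nth_word.
under eq_bigr => i _ do
  rewrite (big_ord1_eq _ (fun j => F (nth 0%N (word D) i) (nth 0%N (word D) j))).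
move: (word D) (size_word D) => s <-; case: s => [|a s] /=; first by rewrite !big_ord0.
(* The last position has no successor, so its term drops out. *)
rewrite big_ord_recr /= ltnn addr0; apply: eq_bigr => i _.
by rewrite ltnS ltn_ord.
Qed.

(* By antisymmetry, the sum over u < v of differences is a sum over all ordered pairs. *)
Lemma sum_deckW (n : nat) (D : deck n 'I_5) (F : nat -> nat -> rat) :
  (forall u v, F u v = - F v u) ->
  \sum_(u : 'I_5) \sum_(v : 'I_5 | (u < v)%O) deckW D u v * F (val u) (val v) =
  adjacent_sum F (head 0%N (word D)) (behead (word D)).
Proof.
move=> Fanti; rewrite -sum_digraphs.
have Fuu u : F u u = 0 by have := Fanti u u; lra.
pose G u v := #|digraphs D u v|%:R * F (val u) (val v).
transitivity (\sum_(u : 'I_5) \sum_(v : 'I_5 | (u < v)%O) G u v +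
              \sum_(u : 'I_5) \sum_(v : 'I_5 | (v < u)%O) G u v).
  (* Exchanging u and v in the second sum produces the v-u digraphs, and antisymmetry of F gives
     them the minus sign in W. *)
  rewrite [X in _ + X](exchange_big_dep predT) //= -big_split; apply: eq_bigr => u _.
  rewrite -big_split; apply: eq_bigr => v _ /=.
  by rewrite /G /deckW (Fanti (val v)); ring.
rewrite -big_split; apply: eq_bigr => u _ /=.
rewrite [RHS](bigID (fun v => (u < v)%O)) /=; congr (_ + _).
rewrite [RHS](bigID (fun v => (v < u)%O)) /= [X in _ + X]big1 ?addr0 => [|v /andP[]].
  by apply: eq_bigl => v; case: ltgtP.
by case: ltgtP => // -> _ _; rewrite Fuu mulr0.
Qed.

End Deck.

Lemma word_sigma k (D : deck 52 'I_k) : word (permute_deck sigma D) = rotr 1 (word D).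
Proof.
apply: (@eq_from_nth _ 0); first by rewrite size_rotr !size_word.
rewrite size_word => j j52; rewrite (nth_word _ (Ordinal j52)) ffunE.
have -> : (sigma^-1)%g (Ordinal j52) = ord_pred (Ordinal j52).
  by apply: (@perm_inj _ sigma); rewrite permKV permE ord_predK.
rewrite -nth_word /rotr /rot size_word nth_cat size_drop size_word.
case: j j52 => [|j] j52; first by rewrite nth_drop.
rewrite ltnNge (_ : (52 - (52 - 1) = 1)%N) // ltnS leq0n /= !subn1 nth_take //.
by rewrite modnDr modn_small // ltnW.
Qed.

Lemma word_sigmaX k (D : deck 52 'I_k) m :
  word (permute_deck (sigma ^+ m)%g D) = iter m (rotr 1) (word D).
Proof.
elim: m => [|m IH] /=.
  by congr word; apply/ffunP => i; rewrite ffunE invg1 perm1.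
rewrite -IH -word_sigma; congr word; apply/ffunP => i.
by rewrite !ffunE expgSr invMg permM.
Qed.

Lemma word_poker_deck : word poker_deck = poker_seq.
Proof.
have wordE : [seq val x | x <- poker_word] = poker_seq.
  by rewrite /poker_word /card_value /= !inordK.
have -> : word poker_deck = [seq val (nth (card_value 5) poker_word i) | i <- iota 0 52].
  rewrite -val_enum_ord -map_comp; apply: eq_map => i /=.
  by rewrite ffunE.
rewrite -wordE (map_comp val (nth (card_value 5) poker_word)).
by rewrite -[52]/(size poker_word) map_nth_iota0 // take_size.
Qed.

(** * Transfer from binary integers to rationals *)

Local Open Scope ring_scope.

Definition ratZ (z : Z) : rat := (int_of_Z z)%:~R.

Lemma ratZD x y : ratZ (Z.add x y) = ratZ x + ratZ y.
Proof. by rewrite /ratZ -intrD; congr (_%:~R); lia. Qed.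

Lemma ratZB x y : ratZ (Z.sub x y) = ratZ x - ratZ y.
Proof. by rewrite /ratZ -intrB; congr (_%:~R); lia. Qed.

Lemma ratZM x y : ratZ (Z.mul x y) = ratZ x * ratZ y.
Proof. by rewrite /ratZ -intrM; congr (_%:~R); lia. Qed.

Lemma ratZ_abs x : ratZ (Z.abs x) = `|ratZ x|.
Proof. by rewrite /ratZ -intr_norm; congr (_%:~R); lia. Qed.

Lemma ratZ_nat n : ratZ (Z.of_nat n) = n%:R.
Proof. by rewrite /ratZ pmulrn; congr (_%:~R); lia. Qed.

Lemma ratZ_N n : ratZ (Z.of_N n) = nr n.
Proof. by rewrite /nr -ratZ_nat; congr ratZ; lia. Qed.

Lemma ratZ_le x y : Z.leb x y -> ratZ x <= ratZ y.
Proof. by move=> xy; rewrite /ratZ ler_int; lia. Qed.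

Lemma ratZ_zsum T (F : nat -> T -> Z) (G : nat -> T -> rat) i l :
  (forall i x, ratZ (F i x) = G i x) -> ratZ (zsum F i l) = isum G i l.
Proof. by move=> FG; elim: l i => //= x l IH i; rewrite ratZD IH FG. Qed.

Lemma ratZ_rsum r chi : ratZ (rsumZ r chi) = rsum r (fun f l i => ratZ (chi f l i)).
Proof.
do 3![apply: ratZ_zsum => ? ?].
by rewrite ratZM ratZ_N mulrC.
Qed.

(** * The cuts of the poker deck *)

Lemma letter_table_tabulates : exists s0 L,
  [/\ size s0 = 20, all (fun b => b < 4)%N s0, arrangements s0 L,
      tabulates (R := rat) L letter_table & perm_eq (s0 ++ nseq 32 4%N) poker_seq].
Proof.
have arr0 : arrangements [::] [:: [::]].
  by split=> // s; rewrite inE; case: s => // a s; apply/esym/negbTE/perm_nilP.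
have /(_ isT) arr1 := fun h => @arrangements_insert 0%N 5 _ _ h arr0.
have /(_ isT) arr2 := fun h => @arrangements_insert 1%N 5 _ _ h arr1.
have /(_ isT) arr3 := fun h => @arrangements_insert 2%N 5 _ _ h arr2.
have /(_ isT) arr4 := fun h => @arrangements_insert 3%N 5 _ _ h arr3.
(* [arr4] supplies the witnesses: s0 is the sorted word of 20 letters, and L the list obtained by
   the four insertions. *)
eexists; eexists; split; [| |exact: arr4| |] => //.
apply: tabulates_insert_max arr3 _ => //.
apply: tabulates_insert_max arr2 _ => //.
apply: tabulates_insert_max arr1 _ => //.
move=> psi; rewrite tsum_push /nr /= mul1r /tsum /= add0r.
by rewrite /insert_words /= big_seq1.
Qed.

(** All cuts of the deck have the same reorderings, so one table serves every m. *)
Lemma sum_poker_reorderings m (psi : nat -> nat -> nat -> nat -> rat) chi :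
  (forall f l p d, (d <= 19)%N -> psi f l p d = chi f l (p + (19 - d))%N) ->
  \sum_(D in reorderings (permute_deck (sigma ^+ m)%g poker_deck)) word_stat psi (word D)
    = rsum deck_table chi.
Proof.
move=> psichi; have [s0 [L [ss0 s04 arr tab ps0]]] := letter_table_tabulates.
have s4 : 4%N \notin s0 by apply/negP => /(allP s04).
have [uL memL] := arrangements_insert 32 s4 arr.
have pD : perm_eq (s0 ++ nseq 32 4%N) (word (permute_deck (sigma ^+ m)%g poker_deck)).
  apply: perm_trans ps0 _; rewrite -word_poker_deck perm_sym; exact: word_permute.
rewrite (sum_reorderings (L := insert_words 4 32 L)); last first.
  by split=> // s; rewrite memL (seq.permPr pD).
exact: (@sum_insert_neutral _ cut_lookup 32 19 s0 L letter_table psi chi isT cut_lookupE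
  ss0 s04 arr tab psichi).
Qed.

(* Otherwise unification may start to evaluate the table. *)
Local Opaque deck_table.

(** This is [excess_check] with the denominators restored; a cut does not change the multiplicities
    of the values. *)
Lemma deckZ_poker m u v : (m < 52)%N ->
  deckZ (permute_deck (sigma ^+ m)%g poker_deck) u v
      / ((num_value (permute_deck (sigma ^+ m)%g poker_deck) u)%:R
         * (num_value (permute_deck (sigma ^+ m)%g poker_deck) v)%:R) =
    (32 * ((asc_pair u v)%:R - (asc_pair v u)%:R)
      + (ratZ (nth Z0 (excess_seq m) u) - ratZ (nth Z0 (excess_seq m) v))) / 160.
Proof.
move=> m52.
have numE w : (num_value (permute_deck (sigma ^+ m)%g poker_deck) w)%:R = ratZ (multiplicity w).
  rewrite num_value_word; have /seq.permP -> := word_permute poker_deck (sigma ^+ m)%g.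
  rewrite word_poker_deck; case: w => -[|[|[|[|[|//]]]]] w5 //.
have /allP/(_ m) := excess_checkP; rewrite mem_iota => /(_ m52).
have ord_iota (w : 'I_5) : val w \in iota 0 5 by rewrite mem_iota ltn_ord.
move=> /allP/(_ _ (ord_iota u))/allP/(_ _ (ord_iota v))/Z.eqb_spec/(congr1 ratZ).
rewrite !(ratZB, ratZM, ratZD, ratZ_nat) -!numE.
rewrite /deckZ !pairs_word word_sigmaX word_poker_deck.
have nz w : (num_value (permute_deck (sigma ^+ m)%g poker_deck) w)%:R != 0 :> rat.
  by rewrite numE /multiplicity; case: ifP.
rewrite -[ratZ 160%BZ]/(160%:R) -[ratZ 32%BZ]/(32%:R).
move: (nz u) (nz v); move: (num_value _ u)%:R (num_value _ v)%:R => a b a0 b0.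
move: (_ - _) (_ * (_ - _) + _) => x y E.
have n160 : 160%:R != 0 :> rat by rewrite pnatr_eq0.
apply/eqP; rewrite eqr_div; [|exact: mulf_neq0|exact: n160].
by rewrite mulrC E mulrC.
Qed.

(** The right-hand side of the hypothesis is antisymmetric in u and v, so [sum_deckW] yields a sum
    along the word, which telescopes to the four statistics. *)
Lemma sum_deckW_deckZ (n : nat) (D D' : deck n.+1 'I_5) (c k : rat) (z : nat -> rat) :
  (forall u v : 'I_5, deckZ D' u v / ((num_value D' u)%:R * (num_value D' v)%:R) =
     (c * ((asc_pair u v)%:R - (asc_pair v u)%:R) + (z u - z v)) / k) ->
  \sum_(u : 'I_5) \sum_(v : 'I_5 | (u < v)%O)
      deckW D u v * deckZ D' u v / ((num_value D' u)%:R * (num_value D' v)%:R) =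
  word_stat (fun f l p d => (c * (p%:R - d%:R) + (z f - z l)) / k) (word D).
Proof.
move=> ZE; pose F u v : rat := (c * ((asc_pair u v)%:R - (asc_pair v u)%:R) + (z u - z v)) / k.
transitivity (\sum_(u : 'I_5) \sum_(v : 'I_5 | (u < v)%O) deckW D u v * F (val u) (val v)).
  by apply: eq_bigr => u _; apply: eq_bigr => v _; rewrite -mulrA ZE.
rewrite (@sum_deckW _ D F); last by move=> u v; rewrite /F; ring.
have wD : all (fun b => b < 5)%N (word D) by apply/allP => _ /mapP[i _ ->]; apply: ltn_ord.
have := size_word D; case: (word D) wD => // a s /= /andP[a5 s5] _.
rewrite (@adjacent_sum_asc_des _ 5 (c / k) (fun u => z u / k)) //; last first.
  by move=> u v _ _; rewrite /F; ring.
by rewrite /word_stat /=; ring.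
Qed.

Lemma addr_subK (V : zmodType) (p q d : V) : p + (q - d) - q = p - d.
Proof. by rewrite addrAC -addrA addKr. Qed.

Lemma normr_scale (K : numFieldType) (x y k : K) : 0 <= x -> 0 <= k ->
  `|x * (y / k)| = x / k * `|y|.
Proof.
by move=> x0 k0; rewrite normrM normf_div (ger0_norm x0) (ger0_norm k0) mulrA mulrAC.
Qed.

Lemma kappa_scale (K : numFieldType) (x y : K) :
  2^-1 * (52%:R / (2%:R * y) / 160%:R * x) = 13%:R * x / (160%:R * y).
Proof. by rewrite !invfM; move: y^-1 => z; field. Qed.

Lemma kappa1_bar_poker m : (m < 52)%N ->
  kappa1_bar (permute_deck (sigma ^+ m)%g poker_deck) =
    ratZ (13 * total_score deck_table m)%BZ
      / ratZ (160 * rsumZ deck_table (fun _ _ _ => 1%BZ))%BZ.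
Proof.
move=> m52; set D' := permute_deck _ _; rewrite /kappa1_bar.
have cardE : #|reorderings D'|%:R = ratZ (rsumZ deck_table (fun _ _ _ => 1%BZ)).
  rewrite ratZ_rsum -(sum_poker_reorderings m (psi := fun _ _ _ _ => 1)) //.
  by rewrite -sum1_card natr_sum.
pose z u := ratZ (nth Z0 (excess_seq m) u).
pose psi f l p d : rat := `|32%:R * (p%:R - d%:R) + (z f - z l)|.
have c1E D : D \in reorderings D' ->
    `|c1 D D'| = 52%:R / (2%:R * #|reorderings D'|%:R) / 160%:R * word_stat psi (word D).
  move=> _; rewrite /c1 (@sum_deckW_deckZ _ D D' 32%:R 160%:R z); last first.
    by move=> u v; apply: deckZ_poker.
  rewrite /word_stat; apply: normr_scale; last exact: ler0n.
  move: #|reorderings D'| => q.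
  by apply: divr_ge0; [|apply: mulr_ge0]; exact: ler0n.
rewrite (eq_bigr _ c1E) -mulr_sumr.
rewrite (sum_poker_reorderings m (chi := fun f l i => ratZ (score (excess_seq m) f l i))).
  rewrite cardE -(ratZ_rsum deck_table (score (excess_seq m))) -/(total_score deck_table m).
  move: (total_score deck_table m) (rsumZ deck_table _) => x y.
  rewrite !ratZM -[ratZ 13%BZ]/(13%:R) -[ratZ 160%BZ]/(160%:R).
  move: (ratZ x) (ratZ y) => {}x {}y.
  exact: kappa_scale.
move=> f l p d d19; rewrite /psi /score ratZ_abs !(ratZB, ratZD, ratZM).
rewrite ratZ_nat natrD (natrB _ d19) -[ratZ 32%BZ]/(32%:R) -[ratZ 19%BZ]/(19%:R).
rewrite addr_subK; reflexivity.
Qed.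

Lemma ratZ_div (x y : Z) (b c : N) : Z.ltb Z0 y -> c != N0 ->
  Z.mul x (Z.of_N c) = Z.mul y (Z.of_N b) -> ratZ x / ratZ y = b%:R / c%:R.
Proof.
move=> y0 c0 /(congr1 ratZ); rewrite !ratZM !ratZ_N /nr => E.
have yn0 : ratZ y != 0 by rewrite gt_eqF // /ratZ ltr0z; lia.
have cn0 : c%:R != 0 :> rat by rewrite pnatr_eq0; lia.
by apply/eqP; rewrite eqr_div // E mulrC.
Qed.

(** An arbitrary r keeps this arithmetic away from the computed table; the common denominator is
    positive and can be cancelled. *)
Lemma kappa_check_spec r : kappa_check r ->
  [/\ ratZ (13 * total_score r 0)%BZ / ratZ (160 * rsumZ r (fun _ _ _ => 1%BZ))%BZ
         = 1041539930128654272599%num%:R / 123600572196960202344%num%:R,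
      ratZ (13 * total_score r 16)%BZ / ratZ (160 * rsumZ r (fun _ _ _ => 1%BZ))%BZ
         = 523485619699747366033%num%:R / 126685078454994859800%num%:R
    & forall m, (m < 52)%N ->
        ratZ (13 * total_score r 16)%BZ / ratZ (160 * rsumZ r (fun _ _ _ => 1%BZ))%BZ
          <= ratZ (13 * total_score r m)%BZ / ratZ (160 * rsumZ r (fun _ _ _ => 1%BZ))%BZ].
Proof.
rewrite /kappa_check; move: (total_score r) (rsumZ r _) => s t.
case/and4P=> t0 /Z.eqb_spec s0 /Z.eqb_spec s16 /allP smin.
have t160 : Z.ltb Z0 (160 * t)%BZ by lia.
split=> [||m m52]; [exact: ratZ_div | exact: ratZ_div |].
rewrite ler_pM2r; last by rewrite invr_gt0 /ratZ ltr0z; lia.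
have /smin sm : m \in iota 0 52 by rewrite mem_iota.
by apply: ratZ_le; lia.
Qed.

Theorem mainTheorem3 :
  [/\ kappa1_bar poker_deck =
        1041539930128654272599%num%:R / 123600572196960202344%num%:R,
      kappa1_bar (permute_deck (sigma ^+ 16)%g poker_deck) =
        523485619699747366033%num%:R / 126685078454994859800%num%:R
    & forall m : nat, (m <= 51)%N ->
        kappa1_bar (permute_deck (sigma ^+ 16)%g poker_deck)
          <= kappa1_bar (permute_deck (sigma ^+ m)%g poker_deck)].
Proof.
have [k0 k16 kmin] := kappa_check_spec kappa_checkP.
split=> [||m m51].
- have <- : permute_deck (sigma ^+ 0)%g poker_deck = poker_deck.
    by apply: word_inj; exact: (word_sigmaX poker_deck 0).
  exact: (etrans (kappa1_bar_poker (m := 0) isT) k0).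
- exact: (etrans (kappa1_bar_poker (m := 16) isT) k16).
rewrite (kappa1_bar_poker (m := 16) isT) (kappa1_bar_poker m51).
exact: kmin.
Qed.
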